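(* If $\mathfrak d=\mathfrak c$, then for every finite family $\mathscr F$ of finitary operations on $\omega^\omega$ there exists a $\langle\mathfrak d,\mathscr F,\mathfrak c\rangle$-pathway. Consequently, if $\mathfrak d=\mathfrak c$, we get a new proof that there are both P-points and gruff ultrafilters.
   Context: $\mathfrak c=2^{\aleph_0}$. For $f,g\in\omega^\omega$, $f\le^* g$ means $f(n)\le g(n)$ for all but finitely many $n$; $\mathfrak d$ is the least cardinality of a set $X\subseteq\omega^\omega$ such that every $f\in\omega^\omega$ satisfies $f\le^* g$ for some $g\in X$, and it is identified with the triple $\langle\omega^\omega,\omega^\omega,\le^*\rangle$. For a collection $\mathscr F$ of finitary operations on $\omega^\omega$ (functions $F:(\omega^\omega)^n\to\omega^\omega$, $n<\omega$) and a regular cardinal $\kappa$, a $\langle\mathfrak d,\mathscr F,\kappa\rangle$-pathway is an increasing continuous sequence $\langle B_\alpha : \alpha<\kappa\rangle$ of subsets of $\omega^\omega$ (continuous: $B_\alpha=\bigcup_{\xi<\alpha}B_\xi$ for limit $\alpha$) such that (1) $\bigcup_{\alpha<\kappa}B_\alpha=\omega^\omega$; (2) for every $\alpha<\kappa$ there is $x\in\omega^\omega$ with $x\not\le^* y$ for all $y\in B_\alpha$; (3) each $B_\alpha$ is closed under every $F\in\mathscr F$. A P-point is a nonprincipal ultrafilter $u$ on $\omega$ such that every countable subfamily of $u$ has a pseudointersection in $u$. A subset of $\mathbb Q$ is perfect if it is closed in $\mathbb Q$ and crowded, i.e. has no isolated points (topology inherited from $\mathbb R$). An ultrafilter $u$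 on $\mathbb Q$ is gruff if $(\forall A\in u)(\exists P\in u)(P\text{ is perfect and }P\subseteq A)$.
   Formalization: The formal notion of pathway does not require κ to be regular, because d = c does not imply that c is regular; when c is regular it is the paper's notion. *)

(* Defs.v *)
From mathcomp Require Import all_boot all_order all_algebra.
From mathcomp Require Import all_classical all_reals.
From mathcomp Require Import topology normedtype.
From mathcomp Require wochoice.

Set Implicit Arguments.
Unset Strict Implicit.
Unset Printing Implicit Defensive.

Import Order.TTheory GRing.Theory Num.Theory.
Import numFieldNormedType.Exports.

Local Open Scope classical_set_scope.
Local Open Scope card_scope.

Definition strict (T : Type) (R : rel T) (x y : T) : Prop := R x y /\ x <> y.

(* Cardinals are initial ordinals: a cardinal is a well-ordered type none of   *)
(* whose proper initial segments {y | y < x} is equipotent to the whole type.  *)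
Record cardinal := Cardinal {
  ordinals_below :> Type;
  ole : rel ordinals_below;
  ole_wo : wochoice.well_order ole;
  ole_initial : forall x : ordinals_below,
    ~ ([set: ordinals_below] #<= [set y | strict ole y x]) }.
Arguments ole {c} _ _.

Definition olt (k : cardinal) : k -> k -> Prop := strict ole.

Lemma cardinal_exists (T : Type) : exists k : cardinal, [set: T] #= [set: k].
Proof.
have [R Rwo] := wochoice.well_ordering_principle {classic T}.
have wmin (P : T -> Prop) : (exists x, P x) ->
    exists x, P x /\ forall y, P y -> R x y.
  case=> x Px; have [|z [[Pz zmin] _]] := Rwo [pred x | `[< P x >]].
    by exists x; apply/asboolP.
  exists z; split; first by move/asboolP: Pz.
  by move=> y Py; apply: zmin; apply/asboolP.
have Rxx x : R x x.
  by have [|z [-> zz]] := wmin (eq^~ x); [exists x | exact: zz].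
have Ranti x y : R x y -> R y x -> x = y.
  move=> xy yx.
  have [|z [_ zuniq]] := Rwo [pred z : {classic T} | `[< z = x \/ z = y >]].
    by exists x; apply/asboolP; left.
  have -> : x = z.
    apply/esym/zuniq; split; first by apply/asboolP; left.
    by move=> t /asboolP[->//|->].
  apply: zuniq; split; first by apply/asboolP; right.
  by move=> t /asboolP[->//|->].
have woP (U : Type) (f : U -> T) : injective f ->
    wochoice.well_order (fun x y : U => R (f x) (f y)).
  move=> fI A [x xA].
  have [|t [[z [zA <-]] tmin]] := wmin (fun t => exists z, z \in A /\ f z = t).
    by exists (f x); exists x.
  exists z; split; first by split=> // y yA; apply: tmin; exists y.
  move=> y [yA ymin]; apply: fI; apply: Ranti; last exact: ymin.
  by apply: tmin; exists y.
pose seg x := [set y : T | R y x /\ y <> x].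
have [/wmin[x [Tx xmin]]|nseg] := pselect (exists x, [set: T] #<= seg x).
  have ini (u : seg x) : ~ ([set: seg x] #<=
      [set v : seg x | R (set_val v) (set_val u) /\ v <> u]).
    move=> le; have /set_mem[ux xu] : set_val u \in seg x := valP u.
    apply/xu/Ranti => //; apply: xmin.
    apply: card_le_trans Tx _; rewrite -(card_le_eql (card_setT (seg x))).
    apply: card_le_trans le _; rewrite -(card_le_eql (inj_card_eq (in2W val_inj))).
    apply: subset_card_le => _ [v [vu vu_neq] <-]; split=> // vuE.
    by apply: vu_neq; exact: val_inj.
  exists (Cardinal (woP _ _ val_inj) ini).
  change ([set: T] #= [set: seg x]); rewrite card_eqPle.
  rewrite (card_le_eqr (card_setT (seg x))) Tx /=.
  by rewrite (card_le_eql (card_setT (seg x))) card_leT.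
exists (@Cardinal T R Rwo (fun x h => nseg (ex_intro _ x h))).
exact: card_eqxx.
Qed.

Definition card_of (T : Type) : cardinal := projT1 (cid (cardinal_exists T)).

Lemma card_ofP (T : Type) : [set: T] #= [set: card_of T].
Proof. exact: projT2 (cid (cardinal_exists T)). Qed.

Definition continuum : cardinal := card_of (set nat).

(* alpha is neither the least ordinal nor a successor. *)
Definition limit_ordinal (k : cardinal) (alpha : k) : Prop :=
  (exists xi, olt xi alpha) /\
  forall xi, olt xi alpha -> exists2 eta, olt xi eta & olt eta alpha.

Definition baire : Type := nat -> nat.

Definition eventually_le (f g : baire) : Prop :=
  finite_set [set n | ~ (f n <= g n)%N].

Definition dominating (X : set baire) : Prop :=
  forall f, exists2 g, X g & eventually_le f g.

(* k is the least cardinality of a dominating family. *)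
Definition is_dominating_number (k : cardinal) : Prop :=
  (exists2 X, dominating X & X #= [set: k]) /\
  (forall X, dominating X -> [set: k] #<= X).

Record operation := Operation {
  arity : nat;
  op_fun :> ('I_arity -> baire) -> baire }.

Definition closed_under (A : set baire) (F : operation) : Prop :=
  forall x : 'I_(arity F) -> baire, (forall i, A (x i)) -> A (F x).

(* Regularity of k is not built in: \mathfrak d = \mathfrak c does not entail    *)
(* that the continuum is regular, and none of the clauses depends on it.       *)
Record pathway (FF : set operation) (k : cardinal) (B : k -> set baire) : Prop := {
  pathway_increasing : forall xi alpha : k, ole xi alpha -> B xi `<=` B alpha;
  pathway_continuous : forall alpha : k, limit_ordinal alpha ->
    B alpha = \bigcup_(xi in [set xi | olt xi alpha]) B xi;
  pathway_cover : \bigcup_alpha B alpha = setT;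
  pathway_unbounded : forall alpha, exists x,
    forall y, B alpha y -> ~ eventually_le x y;
  pathway_closed : forall alpha F, FF F -> closed_under (B alpha) F }.

Definition nonprincipal (T : Type) (u : set_system T) : Prop :=
  forall x, u <> principal_filter x.

Definition pseudointersection (T : Type) (S : set_system T) (X : set T) : Prop :=
  forall A, S A -> finite_set (X `\` A).

(* That X is infinite need not be required in the last clause: members of a    *)
(* nonprincipal ultrafilter are infinite.                                      *)
Definition p_point (u : set_system nat) : Prop :=
  [/\ UltraFilter u, nonprincipal u &
      forall S : set_system nat, countable S -> S `<=` u ->
        exists2 X, u X & pseudointersection S X].

(* The rationals with the subspace topology inherited from R. *)
Notation rat_in R := (initial_topology (ratr : rat -> R)).

Definition perfect_rat (R : realType) (P : set rat) : Prop :=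
  closed (P : set (rat_in R)) /\ isolated (P : set (rat_in R)) = set0.

Definition gruff (R : realType) (u : set_system rat) : Prop :=
  UltraFilter u /\
  forall A, u A -> exists P, [/\ u P, perfect_rat R P & P `<=` A].

(* Main.v *)
Require Import Defs.
From mathcomp Require Import all_boot all_order all_algebra.
From mathcomp Require Import all_classical all_reals.
From mathcomp Require Import topology normedtype trigo pi_irrational.
From mathcomp Require Import lra.

(** Write c for the continuum.  All three conclusions come from one consequence
    of d = c: a family of fewer than c functions on omega is not dominating.
    The families that occur are indexed by finite words whose letters are
    natural numbers or ordinals below a fixed alpha < c.  There are fewer than
    c such words, because a square of an infinite set has the size of the set
    ([embeds_square], hence [words_lt_continuum]).

    Pathways.  Enumerate the functions as s(xi), xi < c, and let B(alpha) be
    the closure of {s(xi) | xi < alpha} under the operations.  Its elements are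
    values of finite terms, so B(alpha) is a union along the smaller ordinals
    at limits, and the terms are coded by words, so B(alpha) is not
    dominating.

    Ultrafilters.  Both are built in c steps from a decreasing sequence of
    sets ([transfinite_construction]).  One fixes a notion of positive set and
    keeps every finite intersection of the sets chosen so far positive; at step
    alpha a new set is added that settles the task number alpha.  The finite
    intersections present at step alpha are indexed by words over alpha, and
    the new set is defined from a function g growing fast enough, infinitely
    often, for each of these words.  [fast_growth] produces such a g even when
    the demand on g(n+1) depends on the value g(n).

    For P-points the positive sets are the nonempty ones and this is Ketonen's
    argument: given S_0, S_1, ..., either some intersection of finitely many of
    the S_i misses a set already present, and the complement of that
    intersection can be added, or one adds, for all n, the elements common to
    S_0, ..., S_n that are at most g(n+1).

    For gruff ultrafilters the positive sets are the non-scattered sets of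
    rationals, those that contain a nonempty crowded set.  The scattered sets
    form an ideal, so for each A one of A and its complement has non-scattered
    trace on every set already present.  Starting from the final segments of
    the line, which leave every bounded set, a closed P inside A is found that
    still meets each of these traces in a non-scattered set
    ([closed_refinement]).  So the ultrafilter is generated by closed sets.
    Inside a closed set C of the ultrafilter, the largest crowded subset K is
    closed; the ultrafilter contains K, since the complement of K contains no
    non-scattered subset of C.  So K is the perfect set required. *)

Set Implicit Arguments.
Unset Strict Implicit.
Unset Printing Implicit Defensive.

Import Order.TTheory GRing.Theory Num.Theory.
Import numFieldNormedType.Exports.

Local Open Scope classical_set_scope.
Local Open Scope card_scope.

(** * Comparing sizes by injections *)

Definition embeds (U V : Type) := exists f : U -> V, injective f.

Lemma embeds_trans (U V W : Type) : embeds U V -> embeds V W -> embeds U W.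
Proof. by move=> [f fI] [g gI]; exists (g \o f); exact: inj_comp. Qed.

Lemma embeds_pair (U V U' V' : Type) :
  embeds U U' -> embeds V V' -> embeds (U * V) (U' * V').
Proof.
move=> [f fI] [g gI]; exists (fun p => (f p.1, g p.2)).
by move=> [a b] [a' b'] /= [/fI -> /gI ->].
Qed.

(** A maximal partial injection from [U] to [V] is defined on all of [U] or
    reaches all of [V]. *)
Lemma embeds_total (U V : Type) : embeds U V \/ embeds V U.
Proof.
pose P := [set G : set (U * V) |
  forall p q, G p -> G q -> p.1 = q.1 <-> p.2 = q.2].
have [F FP Ftot|G [GP Gmax]] := @Zorn_bigcup _ P.
  move=> p q [X FX Xp] [Y FY Yq].
  by have [XY|YX] := Ftot _ _ FX FY; [apply: FP FY _ _ (XY _ Xp) Yq|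
    apply: FP FX _ _ Xp (YX _ Yq)].
have [/choice[f fP]|/existsNP[a /forallNP aG]] :=
    pselect (forall a, exists b, G (a, b)).
  by left; exists f => a a' E; apply/(GP (a, f a) (a', f a')).
have [/choice[f fP]|/existsNP[b /forallNP bG]] :=
    pselect (forall b, exists a, G (a, b)).
  by right; exists f => b b' E; apply/(GP (f b, b) (f b', b')).
exfalso; apply: (Gmax (G `|` [set (a, b)])).
  split=> [p Gp|]; first by left.
  by move=> /(_ (a, b)) GG; apply: (aG b); apply: GG; right.
move=> [x y] [x' y'] /= [Gp|[-> ->]] [Gq|[-> ->]] //.
- exact: GP Gp Gq.
- by split=> E; exfalso; [apply: (aG y); rewrite -E|apply: (bG x); rewrite -E].
- by split=> E; exfalso; [apply: (aG y'); rewrite E|apply: (bG x'); rewrite E].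
Qed.

(** Two distinct points of [X] serve as tags: [X * X] contains two disjoint
    copies of [X]. *)
Lemma embeds_sum_square (X : Type) (x0 x1 : X) (U V : Type) : x0 <> x1 ->
  embeds (X * X) X -> embeds U X -> embeds V X -> embeds (U + V) X.
Proof.
move=> x01 [p pI] [f fI] [g gI].
exists (fun s => match s with inl u => p (f u, x0) | inr v => p (g v, x1) end).
move=> [u|v] [u'|v'] /pI[].
- by move=> /fI ->.
- by [].
- by move=> _ /esym.
- by move=> /gI ->.
Qed.

Lemma embeds_split (Y : Type) (S : set Y) :
  embeds Y ({y | S y} + {y | ~ S y}).
Proof.
exists (fun y => match pselect (S y) with
  | left h => inl (exist _ y h) | right h => inr (exist _ y h) end).
by move=> y y'; case: pselect => h; case: pselect => h' // [].
Qed.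

Lemma embeds_nat_square : embeds (nat * nat) nat.
Proof. exists pickle; exact: (pcan_inj pickleK). Qed.

(** * Squares of infinite types *)

Section square.
Variable Y : Type.

(** A graph of an injection from S * S to S determines S through its
    restriction to the diagonal. *)
Definition carrier (G : set (Y * Y * Y)) : set Y := [set y | exists z, G (y, y, z)].

(** Only totality and injectivity are asked for, so that the property passes to
    unions of chains; an actual injection is extracted by choice. *)
Definition square_graph (G : set (Y * Y * Y)) : Prop :=
  [/\ forall a b c, G (a, b, c) -> [/\ carrier G a, carrier G b & carrier G c],
      forall a b, carrier G a -> carrier G b -> exists c, G (a, b, c) &
      forall p p' c, G (p, c) -> G (p', c) -> p = p'].

Lemma square_graph_bigcup (F : set (set (Y * Y * Y))) :
  F `<=` square_graph -> total_on F subset ->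
  square_graph (\bigcup_(X in F) X).
Proof.
move=> FP Ftot.
have carrierF X y : F X -> carrier X y -> carrier (\bigcup_(X in F) X) y.
  by move=> FX [z Xz]; exists z, X.
split.
- move=> a b c [X FX Xabc]; have [XP _ _] := FP _ FX.
  by have [? ? ?] := XP _ _ _ Xabc; split; exact: carrierF FX _.
- move=> a b [c [X FX Xc]] [d [Z FZ Zd]].
  have [XZ|ZX] := Ftot _ _ FX FZ.
    have [_ + _] := FP _ FZ => /(_ a b)[||e Ze]; [|by exists d|by exists e, Z].
    by exists c; exact: XZ.
  have [_ + _] := FP _ FX => /(_ a b)[||e Xe]; [by exists c| |by exists e, X].
  by exists d; exact: ZX.
- move=> p p' c [X FX Xc] [Z FZ Zc].
  have [XZ|ZX] := Ftot _ _ FX FZ.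
    by have [_ _] := FP _ FZ; apply; [exact: XZ Xc|exact: Zc].
  by have [_ _] := FP _ FX; apply; [exact: Xc|exact: ZX Zc].
Qed.

(** If a copy [i Z] of a type [Z] with Z * Z inside Z lies outside the carrier
    S, and S itself fits into [Z], then the pairs over S together with [i Z]
    that are not already treated can be sent injectively into [i Z]. *)
Lemma square_graph_extend (G : set (Y * Y * Y)) (Z : Type) (z0 z1 : Z)
    (i : Z -> Y) :
  square_graph G -> z0 <> z1 -> embeds (Z * Z) Z -> embeds {y | carrier G y} Z ->
  injective i -> (forall z, ~ carrier G (i z)) ->
  exists2 G', G `<` G' & square_graph G'.
Proof.
move=> [GF GT GI] z01 ZZ SZ iI iS.
set S := carrier G in SZ iS.
pose S' := [set y | S y \/ exists z, y = i z].
have [j jI] : exists j : Y -> Z,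
    forall y y', S' y -> S' y' -> j y = j y' -> y = y'.
  have [f fI] := embeds_sum_square z01 ZZ SZ (ex_intro _ id (@inj_id Z)).
  have h y : exists t : ({y | S y} + Z), S' y ->
      match t with inl s => sval s = y | inr z => i z = y end.
    have [[Sy|[z yE]]|nS] := pselect (S' y).
    - by exists (inl (exist _ y Sy)).
    - by exists (inr z).
    - by exists (inr z0).
  have {h}[k kP] := choice h.
  exists (f \o k) => y y' /kP hy /kP hy' /fI kE.
  by move: hy hy'; rewrite kE; case: (k y') => [s|z] <- <-.
have [p pI] := ZZ.
pose N := [set t : Y * Y * Y | [/\ S' t.1.1, S' t.1.2, ~ (S t.1.1 /\ S t.1.2) &
   t.2 = i (p (j t.1.1, j t.1.2))]].
have FS y : carrier (G `|` N) y <-> S' y.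
  split=> [[z [Gz|[]]]|S'y]; [by left; exists z|by []|].
  have [[z Gz]|nSy] := pselect (S y); first by exists z; left.
  by exists (i (p (j y, j y))); right; split=> // -[].
exists (G `|` N).
  (* Properness: the point [i z0] has been added to the carrier. *)
  split=> [t Gt|GN]; first by left.
  apply: (iS z0); have [z t] : carrier (G `|` N) (i z0) by apply/FS; right; exists z0.
  by exists z; exact: GN.
split.
- move=> a b c [Gt|[/= S'a S'b _ ->]].
    by have [Sa Sb Sc] := GF _ _ _ Gt; split; apply/FS; left.
  by split; apply/FS => //; right; eexists.
- move=> a b /FS S'a /FS S'b.
  have [[Sa Sb]|nS] := pselect (S a /\ S b).
    by have [c Gc] := GT _ _ Sa Sb; exists c; left.
  by exists (i (p (j a, j b))); right.
- move=> [a b] [a' b'] c [Gt|[/= Sa Sb _ ->]] [Gt'|[/= Sa' Sb' _]].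
  + exact: GI Gt Gt'.
  + by move=> cE; have [_ _] := GF _ _ _ Gt; rewrite cE => /iS.
  + by have [_ _ /iS] := GF _ _ _ Gt'.
  + by move=> /iI /pI[/jI -> // /jI ->].
Qed.

End square.

(** Hessenberg's theorem.  A maximal square graph on S cannot be extended.  If S
    is infinite, it therefore does not embed into its complement, so the
    complement embeds into S and S is as large as [Y].  If S is countable, a copy of [nat] in the complement would extend
    the graph, so the complement is countable too and [Y] is countable. *)
Theorem embeds_square (Y : Type) : embeds nat Y -> embeds (Y * Y) Y.
Proof.
move=> natY.
have [Ynat|] := pselect (embeds Y nat).
  apply: embeds_trans (embeds_pair Ynat Ynat) _.
  exact: embeds_trans embeds_nat_square natY.
move=> nYnat.
have [G [GP Gmax]] := Zorn_bigcup (@square_graph_bigcup Y).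
have [GF GT GI] := GP.
pose S := {y | carrier G y}.
have SY : embeds S Y.
  by exists sval => -[y Sy] [y' Sy'] /= yE; case: _ / yE Sy' => Sy';
    rewrite (Prop_irrelevance Sy Sy').
(* [Gmax] in usable form: no suitable [Z] lies outside the carrier. *)
have noext Z (z0 z1 : Z) : z0 <> z1 -> embeds (Z * Z) Z -> embeds S Z ->
    embeds Z {y | ~ carrier G y} -> False.
  move=> z01 ZZ SZ [i iI].
  have [z z'|z|G' GG' G'P] := @square_graph_extend _ G Z z0 z1 (sval \o i) GP z01 ZZ SZ.
  - move=> /= E; apply: iI; case: (i z) (i z') E => [y h] [y' h'] /= E.
    by case: _ / E h' => h'; rewrite (Prop_irrelevance h h').
  - exact: (svalP (i z)).
  - exact: Gmax GG' G'P.
have YS := @embeds_split Y (carrier G).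
have [natS|Snat] := embeds_total nat S.
  have SS : embeds (S * S) S.
    have h (st : S * S) : exists c : S, G (sval st.1, sval st.2, sval c).
      case: st => [[a Sa] [b Sb]] /=; have [c Gc] := GT _ _ Sa Sb.
      by have [_ _ Sc] := GF _ _ _ Gc; exists (exist _ c Sc).
    have [f fP] := choice h; exists f => -[a b] [a' b'] E.
    have := fP (a, b); rewrite E => /GI/(_ (fP (a', b')))[].
    have [s sI] := SY.
    case: a a' b b' {E} => [a ha] [a' ha'] [b hb] [b' hb'] /= E E'.
    case: _ / E ha' => ha'; case: _ / E' hb' => hb'.
    by rewrite (Prop_irrelevance ha ha') (Prop_irrelevance hb hb').
  have [f fI] := natS.
  have f01 : f 0%N <> f 1%N by move=> /fI.
  have [nSS|SnS] := embeds_total {y | ~ carrier G y} S.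
    have YtoS : embeds Y S.
      apply: embeds_trans YS _; apply: embeds_sum_square f01 SS _ nSS.
      by exists id; exact: inj_id.
    apply: embeds_trans (embeds_pair YtoS YtoS) _.
    exact: embeds_trans SS SY.
  by exfalso; apply: noext f01 SS _ SnS; exists id; exact: inj_id.
have n01 : 0%N <> 1%N by [].
have [nSnat|natnS] := embeds_total {y | ~ carrier G y} nat.
  exfalso; apply: nYnat; apply: embeds_trans YS _.
  exact: embeds_sum_square n01 embeds_nat_square Snat nSnat.
by exfalso; apply: noext n01 embeds_nat_square Snat natnS.
Qed.

(** Iterated pairing forgets only the length, which is therefore recorded. *)
Lemma embeds_seq (Y : Type) : embeds nat Y -> embeds (seq Y) Y.
Proof.
move=> natY; have [p pI] := embeds_square natY; have [n nI] := natY.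
pose code := foldr (fun y t => p (y, t)) (n 0%N).
exists (fun s => p (n (size s), code s)) => s t /pI[/nI].
elim: s t => [|y s IHs] [|z t] //= [st] /pI[-> E].
by rewrite (IHs t).
Qed.

Lemma embeds_seq_nat_sum (X : Type) :
  embeds (seq (nat + X)) nat \/ embeds (seq (nat + X)) X.
Proof.
have [Xnat|natX] := embeds_total X nat.
  have NX : embeds (nat + X) nat.
    apply: (@embeds_sum_square _ 0%N 1%N) embeds_nat_square _ Xnat => //.
    by exists id; exact: inj_id.
  have NN : embeds nat nat by exists id; exact: inj_id.
  left; apply: embeds_trans (embeds_seq NN).
  by have [f fI] := NX; exists (map f); exact: inj_map.
right; have [f fI] := natX; apply: embeds_trans (embeds_seq natX).
have f01 : f 0%N <> f 1%N by move=> /fI.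
have [|g gI] := embeds_sum_square f01 (embeds_square natX) natX (_ : embeds X X).
  by exists id; exact: inj_id.
by exists (map g); exact: inj_map.
Qed.

(** * Words over an ordinal below the continuum *)

Lemma card_le_embeds (U V : Type) : [set: U] #<= [set: V] -> embeds U V.
Proof.
move=> /card_leP[f]; exists (fun x => set_val (f (to_setT x))) => x y.
by move=> /val_inj/(@inj _ _ _ f); rewrite !inE => /(_ Logic.I Logic.I)[].
Qed.

Lemma embeds_card_le (T U : Type) (A : set U) (f : T -> U) :
  injective f -> (forall x, A (f x)) -> [set: T] #<= A.
Proof.
move=> fI fA; have /injfunPex[g] : exists2 g : T -> U, set_fun setT A g & set_inj setT g.
  by exists f => [x _|x y _ _ /fI]; [exact: fA|].
exact: inj_card_le.
Qed.

Definition below (k : cardinal) (alpha : k) : Type := {xi : k | olt xi alpha}.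

(** The index set of every family of size less than c used below: the natural
    numbers are extra letters, available to code countable data. *)
Definition words (k : cardinal) (alpha : k) : Type := seq (nat + below alpha).

Lemma cantor (T : Type) : ~ embeds (set T) T.
Proof.
move=> [f fI]; pose D := [set f A | A in [set A | ~ A (f A)]].
have [D1|D1] := pselect (D (f D)); last by apply: (D1); exists D.
by have [A /= + /fI AD] := D1; rewrite AD.
Qed.

Lemma words_lt_continuum (alpha : continuum) : ~ embeds continuum (words alpha).
Proof.
move=> CW; have [Wnat|Wa] := embeds_seq_nat_sum (below alpha).
  have setC : embeds (set nat) continuum.
    by apply: card_le_embeds; move: (card_ofP (set nat)); rewrite card_eq_le => /andP[].
  exact: cantor (embeds_trans setC (embeds_trans CW Wnat)).
have [f fI] := embeds_trans CW Wa.
apply: (@ole_initial _ alpha); apply: (@embeds_card_le _ _ _ (sval \o f)).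
  move=> x y /= E; apply: fI; case: (f x) (f y) E => [u h] [v h'] /= E.
  by case: _ / E h' => h'; rewrite (Prop_irrelevance h h').
by move=> x; exact: (svalP (f x)).
Qed.

(** The only use of d = c: a family indexed by words is too small to dominate. *)
Lemma words_not_dominating (alpha : continuum) (h : words alpha -> baire) :
  is_dominating_number continuum ->
  exists g, forall w, ~ eventually_le g (h w).
Proof.
move=> [_ dmin]; apply: contrapT => /forallNP hP.
apply: (@words_lt_continuum alpha); apply: card_le_embeds.
apply: card_le_trans (dmin (range h) _) (card_image_le _ _).
move=> g; have /existsNP[w /contrapT gw] := hP g.
by exists (h w) => //; exists w.
Qed.

(** * The order of an initial ordinal *)

Section cardinal_order.
Variable k : cardinal.
Implicit Types x y z : k.

Lemma ole_min (P : k -> Prop) :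
  (exists x, P x) -> exists2 z, P z & forall y, P y -> ole z y.
Proof.
case=> x Px; have [|z [[Pz zmin] _]] := @ole_wo k [pred x | `[< P x >]].
  by exists x; apply/asboolP.
exists z; first by move/asboolP: Pz.
by move=> y Py; apply: zmin; apply/asboolP.
Qed.

Lemma ole_refl x : ole x x.
Proof. by have [|z -> ] := @ole_min (eq^~ x); [exists x|apply]. Qed.

Lemma ole_anti x y : ole x y -> ole y x -> x = y.
Proof.
move=> xy yx; have [|z [_ zuniq]] := @ole_wo k [pred z | `[< z = x \/ z = y >]].
  by exists x; apply/asboolP; left.
have zx : z = x.
  apply: zuniq; split; first by apply/asboolP; left.
  by move=> t /asboolP[->|->//]; exact: ole_refl.
rewrite -zx; apply: zuniq; split; first by apply/asboolP; right.
by move=> t /asboolP[->//|->]; exact: ole_refl.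
Qed.

Lemma olt_total x y : [\/ olt x y, x = y | olt y x].
Proof.
have [->|xy] := pselect (x = y); first by constructor 2.
have [|z zP zmin] := @ole_min (fun z => z = x \/ z = y); first by exists x; left.
have [zE|zE] := zP; rewrite zE in zmin.
  by constructor 1; split=> //; apply: zmin; right.
by constructor 3; split; [apply: zmin; left|exact/nesym].
Qed.

Lemma olt_ole_trans x y z : olt x y -> ole y z -> olt x z.
Proof.
move=> [xy nxy] yz; split; last by move=> xz; subst z; apply/nxy/ole_anti.
have [|t tP tmin] := @ole_min (fun t => [\/ t = x, t = y | t = z]).
  by exists x; constructor 1.
case: tP => tE; subst t.
- by apply: tmin; constructor 3.
- by exfalso; apply/nxy/ole_anti => //; apply: tmin; constructor 1.
- have -> : z = y by apply: ole_anti => //; apply: tmin; constructor 2.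
  by [].
Qed.

Lemma ole_trans x y z : ole x y -> ole y z -> ole x z.
Proof.
move=> xy yz; have [->//|nxy] := pselect (x = y).
exact: proj1 (olt_ole_trans (conj xy nxy) yz).
Qed.

Lemma olt_wf : well_founded (@olt k).
Proof.
move=> x; apply: contrapT => nx.
have [|z nz zmin] := @ole_min (fun z => ~ Acc (@olt k) z); first by exists x.
apply: nz; constructor => y [yz nyz]; apply: contrapT => ny.
by apply: nyz; apply: ole_anti => //; exact: zmin.
Qed.

End cardinal_order.

(** * Functions that grow fast infinitely often *)

Section growth.
Variable H : nat -> nat -> nat.

(** [H n u] is the value demanded at [n.+1] of a function with value [u] at [n].
    After [m], a trajectory satisfies the demand made at its own value and at
    all smaller ones: a function that is below it at one place and falls short
    of the demand there remains below it at the next place, although [H] need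
    not be monotone in its second argument. *)
Fixpoint trajectory (m v n : nat) : nat :=
  if n is n'.+1 then
    if (n' < m)%N then v
    else \max_(u < (trajectory m v n').+1) H n' u
  else v.

Lemma trajectory_init m v : trajectory m v m = v.
Proof. by case: m => //= m; rewrite ltnSn. Qed.

Lemma trajectory_step m v n u : (m <= n)%N -> (u <= trajectory m v n)%N ->
  (H n u <= trajectory m v n.+1)%N.
Proof.
move=> mn un /=; rewrite ltnNge mn /=.
exact: (leq_bigmax (Ordinal (un : (u < (trajectory m v n).+1)%N))).
Qed.

End growth.

(** If [g] violates the demand [H w] everywhere from [m] on, then it stays below
    the trajectory of [H w] that starts at [m] with value [g m].  So it
    suffices that no trajectory eventually dominates [g]; the pairs of starting
    data are countably many and are coded in the words. *)
Lemma fast_growth (alpha : continuum) (H : words alpha -> nat -> nat -> nat) :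
  is_dominating_number continuum ->
  exists g : baire, [/\ {homo g : m n / (m <= n)%N},
    forall n, (n <= g n)%N &
    forall w m, exists2 n, (m <= n)%N & (H w n (g n) <= g n.+1)%N].
Proof.
move=> dc.
pose h (w : words alpha) : baire :=
  if w is inl m :: inl v :: w' then trajectory (H w') m v else fun=> 0%N.
have [g0 g0P] := words_not_dominating h dc.
pose g n := (n + \max_(i < n.+1) g0 i)%N.
have gmono : {homo g : m n / (m <= n)%N}.
  move=> m n mn; rewrite leq_add//; apply/bigmax_leqP => i _.
  have iN : (i < n.+1)%N by apply: leq_trans (ltn_ord i) _; rewrite ltnS.
  exact: (leq_bigmax (F := fun j : 'I_n.+1 => g0 j) (Ordinal iN)).
exists g; split=> // [n|w m]; first exact: leq_addr.
apply: contrapT => /forall2NP gH.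
apply: (g0P (inl m :: inl (g m) :: w)); rewrite /eventually_le /=.
have gt n : (m <= n)%N -> (g n <= trajectory (H w) m (g m) n)%N.
  elim: n => [|n IHn]; first by rewrite leqn0 => /eqP ->.
  rewrite leq_eqVlt ltnS => /orP[/eqP <-|mn]; first by rewrite trajectory_init.
  have [/(_ mn)//|/negP] := gH n; rewrite -ltnNge => /ltnW gn.
  exact: leq_trans gn (trajectory_step mn (IHn mn)).
apply: (@sub_finite_set _ _ `I_m); last exact: finite_II.
move=> n /= /negP; rewrite -ltnNge => tn; rewrite ltnNge; apply/negP => mn.
have : (g0 n <= g n)%N.
  apply: leq_trans (leq_addl _ _).
  exact: (leq_bigmax (F := fun j : 'I_n.+1 => g0 j) (ord_max)).
by rewrite leqNgt; move: (leq_ltn_trans (gt _ mn) tn) => ->.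
Qed.

(** * Enumerations *)

(** The default value [x0] allows [S] to be empty. *)
Lemma countable_enum (T : Type) (S : set T) (x0 : T) : countable S ->
  exists e : nat -> T, S `<=` range e /\ forall n, S (e n) \/ e n = x0.
Proof.
move=> /countable_injP[f fI].
have h n : exists x, (S x /\ f x = n) \/ ((forall y, S y -> f y <> n) /\ x = x0).
  have [[x [Sx xn]]|nx] := pselect (exists x, S x /\ f x = n).
    by exists x; left.
  by exists x0; right; split=> // y Sy yn; apply: nx; exists y.
have [e eP] := choice h; exists e; split=> [x Sx|n].
  exists (f x) => //; have [[Se fe]|[nS _]] := eP (f x).
    by apply: fI => //; exact: mem_set.
  by have := nS x Sx.
by have [[Se _]|[_ ->]] := eP n; [left|right].
Qed.

Lemma continuum_onto_set (T : countType) :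
  exists s : continuum -> set T, forall A, exists alpha, s alpha = A.
Proof.
have [f fI] : embeds (set nat) continuum.
  by apply: card_le_embeds; move: (card_ofP (set nat)); rewrite card_eq_le => /andP[].
have h alpha : exists B : set T, forall A : set nat, f A = alpha -> B = (pickle @^-1` A).
  have [[A fA]|nA] := pselect (exists A, f A = alpha).
    by exists (pickle @^-1` A) => A'; rewrite -fA => /fI ->.
  by exists set0 => A fA; case: nA; exists A.
have [s sP] := choice h; exists s => A; exists (f (pickle @` A)).
rewrite (sP _ (pickle @` A)) //; apply/seteqP; split=> [x [y Ay]|x Ax]; last by exists x.
by move=> /(pcan_inj pickleK) <-.
Qed.

Lemma continuum_onto_seq_set :
  exists s : continuum -> nat -> set nat, forall A, exists alpha, s alpha = A.
Proof.
have [s sP] := continuum_onto_set (nat * nat)%type.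
exists (fun alpha n => [set m | s alpha (n, m)]) => A.
have [alpha aE] := sP [set p | A p.1 p.2]; exists alpha.
by rewrite aE; apply/funext => n; apply/seteqP; split.
Qed.

Lemma continuum_onto_baire :
  exists s : continuum -> baire, forall f, exists alpha, s alpha = f.
Proof.
have [s sP] := continuum_onto_set (nat * nat)%type.
have h alpha : exists f : baire, forall f', s alpha = [set p | p.2 = f' p.1] -> f = f'.
  have [[f fE]|nf] := pselect (exists f : baire, s alpha = [set p | p.2 = f p.1]).
    exists f => f'; rewrite fE => /seteqP[ff' _]; apply/funext => n.
    exact: (ff' (n, f n)).
  by exists (fun=> 0%N) => f fE; case: nf; exists f.
have [t tP] := choice h; exists t => f.
have [alpha aE] := sP [set p | p.2 = f p.1]; exists alpha; exact: tP.
Qed.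

(** * Ultrafilters generated in continuum many steps *)

Section meets.
Variables (T : Type) (base : nat -> set T).

Definition word_meet (I : Type) (f : I -> set T) (w : seq (nat + I)) : set T :=
  foldr (fun a X => match a with inl n => base n | inr i => f i end `&` X) setT w.

Lemma word_meet_cat (I : Type) (f : I -> set T) w w' :
  word_meet f (w ++ w') = word_meet f w `&` word_meet f w'.
Proof. by elim: w => [|a w IHw] /=; rewrite ?setTI// IHw setIA. Qed.

Definition letter_in (I : Type) (P : I -> Prop) (w : seq (nat + I)) : Prop :=
  foldr (fun a Q => match a with inl _ => True | inr i => P i end /\ Q) True w.

(** With [letter_in_sval], passes between words over all indices and words over
    a subtype, the form in which a set of earlier stages presents itself. *)
Lemma word_meet_lift (I : Type) (P : I -> Prop) (f : I -> set T) w :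
  letter_in P w -> exists w' : seq (nat + {i | P i}),
    word_meet (fun i => f (sval i)) w' = word_meet f w.
Proof.
elim: w => [|[n|i] w IHw] /=; first by exists [::].
  by move=> [_ /IHw[w' <-]]; exists (inl n :: w').
by move=> [Pi /IHw[w' <-]]; exists (inr (exist _ i Pi) :: w').
Qed.

Lemma letter_in_sval (I : Type) (P : I -> Prop) (f : I -> set T)
    (w : seq (nat + {i | P i})) :
  exists2 w' : seq (nat + I), letter_in P w' &
    word_meet f w' = word_meet (fun i => f (sval i)) w.
Proof.
elim: w => [|[n|[i Pi]] w [w' w'P E]]; first by exists [::].
  by exists (inl n :: w') => //=; rewrite E.
by exists (inr i :: w') => //=; rewrite E.
Qed.

Lemma bigcap_cons n (ns : seq nat) :
  \bigcap_(m in [set` n :: ns]) base m = base n `&` \bigcap_(m in [set` ns]) base m.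
Proof.
apply/seteqP; split=> [x nsx|x [nx nsx] m /=].
  by split=> [|m mns]; apply: nsx => /=; rewrite inE ?eqxx// (mns : m \in ns) orbT.
by rewrite inE => /orP[/eqP->//|]; exact: nsx.
Qed.

(** Sorting a finite intersection by its largest index: what remains involves
    only smaller ordinals, which is what a transfinite induction can use. *)
Lemma word_meet_top (k : cardinal) (P : k -> Prop) (f : k -> set T) w :
  letter_in P w ->
  (exists ns, word_meet f w = \bigcap_(n in [set` ns : seq nat]) base n) \/
  (exists beta w', [/\ P beta, letter_in (@olt k ^~ beta) w' &
     word_meet f w = f beta `&` word_meet f w']).
Proof.
elim: w => [_|a w IHw].
  by left; exists [::]; rewrite set_nil bigcap_set0.
move=> /= [Pa /IHw[[ns E]|[beta [w' [Pb w'b E]]]]].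
  case: a Pa => [n _|i Pi]; first by left; exists (n :: ns); rewrite E bigcap_cons.
  right; exists i, [seq inl n | n <- ns]; split=> //; first by elim: (ns).
  rewrite E; congr (_ `&` _); elim: (ns) => [|n l IHl] /=.
    by rewrite set_nil bigcap_set0.
  by rewrite bigcap_cons IHl.
right; case: a Pa => [n _|i Pi].
  by exists beta, (inl n :: w'); split=> //=; rewrite E setICA.
have [ib|ib|bi] := olt_total i beta.
- by exists beta, (inr i :: w'); split=> //=; rewrite E setICA.
- by exists beta, w'; split=> //; rewrite E ib setIA setIid.
- exists i, (inr beta :: w'); split=> //=; last by rewrite E.
  split=> //; elim: (w') w'b => //= -[n|j] l IHl [jb /IHl lb]; split=> //.
  by apply: olt_ole_trans jb _; have [] := bi.
Qed.

Section construction.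
Variables (Pos : set T -> Prop) (task : continuum -> set T -> Prop).

Hypothesis Pos_base : forall ns : seq nat, Pos (\bigcap_(n in [set` ns]) base n).
(** The form of the family [X] retains what a single step uses: it is closed
    under finite intersections and refines the sequence [base]. *)
Hypothesis step : forall (alpha : continuum) (X : words alpha -> set T),
  (forall w, Pos (X w)) -> (forall w w', X (w ++ w') = X w `&` X w') ->
  (forall n, exists w, X w `<=` base n) ->
  exists2 P, task alpha P & forall w, Pos (P `&` X w).

(** The choice at stage [alpha] given the earlier choices [rec]: it fulfils the
    task and stays compatible with all earlier finite intersections. *)
Let good alpha (rec : forall xi, olt xi alpha -> set T) (P : set T) :=
  task alpha P /\ forall w : words alpha,
    Pos (P `&` word_meet (fun xi => rec (sval xi) (svalP xi)) w).

Let next alpha (rec : forall xi, olt xi alpha -> set T) : set T :=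
  match pselect (exists P, good rec P) with
  | left h => projT1 (cid h) | right _ => setT end.

(** Every finite intersection is positive, by induction on its largest index
    beta: it is the set chosen at beta intersected with earlier sets, and
    positivity is then part of how that set was chosen. *)
Lemma transfinite_construction : exists f : continuum -> set T,
  (forall alpha, task alpha (f alpha)) /\ forall w, Pos (word_meet f w).
Proof.
pose f := Fix (@olt_wf continuum) (fun=> set T) next.
(* Unfolding the well-founded recursion once. *)
have fE alpha : f alpha = next (fun xi (_ : olt xi alpha) => f xi).
  apply: (Fix_eq _ (fun=> set T)) => x u v uv; congr next.
  by apply/functional_extensionality_dep => y; apply/funext => h.
have fP alpha : good (fun xi (_ : olt xi alpha) => f xi) (f alpha).
  elim/(well_founded_ind (@olt_wf continuum)): alpha => alpha IH.
  rewrite [X in good _ X]fE /next; case: pselect => [h|[]]; first exact: projT2 (cid h).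
  have [||n|P tP PP] := step (X := word_meet (fun xi : below alpha => f (sval xi))).
  - move=> w; have [v va <-] := letter_in_sval f w.
    have [[ns ->]|[beta [v' [ba v'b ->]]]] := word_meet_top f va; first exact: Pos_base.
    by have [u <-] := word_meet_lift f v'b; have [_] := IH _ ba.
  - exact: word_meet_cat.
  - by exists [:: inl n] => x [].
  - by exists P; split.
exists f; split=> [alpha|w]; first by have [] := fP alpha.
have wT : letter_in (fun=> True) w by elim: (w) => //= -[].
have [[ns ->]|[beta [v [_ vb ->]]]] := word_meet_top f wT; first exact: Pos_base.
by have [u <-] := word_meet_lift f vb; have [_] := fP beta.
Qed.
End construction.

Definition generated_filter (I : Type) (f : I -> set T) : set_system T :=
  [set A | exists w, word_meet f w `<=` A].

Lemma generated_filter_ultra (I : Type) (f : I -> set T) :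
  (forall w, word_meet f w !=set0) ->
  (forall A, generated_filter f A \/ generated_filter f (~` A)) ->
  UltraFilter (generated_filter f).
Proof.
move=> fne fdec.
have prop : ProperFilter (generated_filter f).
  split=> [[w w0]|]; first by have [x /w0] := fne w.
  split; first by exists [::].
  - by move=> A B [w wA] [v vB]; exists (w ++ v); rewrite word_meet_cat => x [/wA ? /vB].
  - by move=> A B AB [w wA]; exists w => x /wA /AB.
split=> // G GP fG; apply/seteqP; split=> // A GA.
have [//|/fG GnA] := fdec A.
by have : G set0 by [rewrite -(setICr A); exact: filterI]; move=> /filter_not_empty.
Qed.

Lemma generated_filter_base (I : Type) (f : I -> set T) i :
  generated_filter f (f i).
Proof. by exists [:: inr i] => x []. Qed.

Lemma generated_filter_base0 (I : Type) (f : I -> set T) n :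
  generated_filter f (base n).
Proof. by exists [:: inl n] => x []. Qed.
End meets.

(** * Pathways *)

Section pathway.
Variables (FF : set operation) (k : cardinal) (s : k -> baire).

Inductive generated (alpha : k) : baire -> Prop :=
| generated_leaf xi : olt xi alpha -> generated alpha (s xi)
| generated_op F (x : 'I_(arity F) -> baire) :
    FF F -> (forall i, generated alpha (x i)) -> generated alpha (F x).

Lemma generated_mono (xi alpha : k) :
  ole xi alpha -> generated xi `<=` generated alpha.
Proof.
move=> xa x; elim=> [eta ex|F y FF_F _ IH]; last exact: generated_op.
by apply: generated_leaf; exact: olt_ole_trans ex xa.
Qed.

Lemma ole_upper_bound (alpha : k) n (eta : 'I_n -> k) :
  (exists xi, olt xi alpha) -> (forall i, olt (eta i) alpha) ->
  exists2 xi, olt xi alpha & forall i, ole (eta i) xi.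
Proof.
move=> [xi0 xi0a]; elim: n eta => [|n IHn] eta etaa.
  by exists xi0 => // -[].
have [//|xi xia xiP] := IHn (fun i => eta (lift ord0 i)).
have [tx|tx|xt] := olt_total (eta ord0) xi.
- exists xi => // i; have [j ->|->] := unliftP ord0 i; first exact: xiP.
  by have [] := tx.
- exists xi => // i; have [j ->|->] := unliftP ord0 i; first exact: xiP.
  by rewrite tx; exact: ole_refl.
- exists (eta ord0) => // i; have [j ->|->] := unliftP ord0 i; last exact: ole_refl.
  exact: ole_trans (xiP j) (proj1 xt).
Qed.

(** The operations are finitary, and finitely many ordinals below a limit have a
    common bound below it. *)
Lemma generated_limit (alpha : k) x : limit_ordinal alpha ->
  generated alpha x -> exists2 xi, olt xi alpha & generated xi x.
Proof.
move=> [ne lim]; elim=> [eta /lim[xi ex xa]|F y FF_F _ IH].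
  by exists xi => //; exact: generated_leaf.
have {IH}/choice[eta etaP] : forall i, exists xi, olt xi alpha /\ generated xi (y i).
  by move=> i; have [xi ? ?] := IH i; exists xi.
have [i|xi xia xiP] := ole_upper_bound ne (eta := eta); first by have [] := etaP i.
exists xi => //; apply: generated_op => // i.
by apply: generated_mono (xiP i) _ _; have [] := etaP i.
Qed.

Variable op : nat -> operation.
Hypothesis FFop : FF `<=` range op.

(** Terms over the generators below [alpha].  The node label selects the
    operation and missing arguments are read as the zero function, so that
    every tree has a value. *)
Fixpoint eval (alpha : k) (t : GenTree.tree (below alpha)) : baire :=
  match t with
  | GenTree.Leaf xi => s (sval xi)
  | GenTree.Node n ts => op n (fun i => nth (fun=> 0%N) (map (@eval alpha) ts) i)
  end.

Lemma generated_eval alpha x : generated alpha x -> exists t, eval (alpha := alpha) t = x.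
Proof.
elim=> [xi xia|F y /FFop[n _ nF] _ /choice[t tP]]; first by exists (GenTree.Leaf (exist _ xi xia)).
subst F; exists (GenTree.Node n (map t (enum 'I_(arity (op n))))) => /=.
congr (op n _); apply/funext => i.
rewrite -map_comp (nth_map i) /=; last by rewrite size_enum_ord.
by rewrite tP nth_ord_enum.
Qed.

End pathway.

(** If [xi] were the largest element, then all other elements would lie below
    [xi], so words over [xi] would suffice to code the whole continuum. *)
Lemma continuum_no_max (xi : continuum) : exists alpha, olt xi alpha.
Proof.
apply: contrapT => /forallNP nmax.
have max alpha : alpha <> xi -> olt alpha xi.
  by move=> nE; have [|/nE//|/nmax//] := olt_total alpha xi.
apply: (@words_lt_continuum xi).
exists (fun alpha => match pselect (alpha = xi) with
  | left _ => [::] | right h => [:: inr (exist _ alpha (max _ h))] end).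
by move=> a b; case: pselect => [->|h]; case: pselect => [->|h'] // [].
Qed.

Theorem pathway_exists (FF : set operation) :
  is_dominating_number continuum -> finite_set FF ->
  exists B : continuum -> set baire, pathway FF B.
Proof.
move=> dc /finite_set_countable FFc.
have [op [FFop _]] := countable_enum (Operation (fun _ : 'I_0 -> baire => fun=> 0%N)) FFc.
have [s s_onto] := continuum_onto_baire.
exists (generated FF s); split.
- exact: generated_mono.
- move=> alpha lim; apply/seteqP; split=> [x /(generated_limit lim)[xi ? ?]|x [xi xia]].
    by exists xi.
  by apply: generated_mono; have [] := xia.
- rewrite -subTset => x _; have [xi <-] := s_onto x.
  by have [alpha xia] := continuum_no_max xi; exists alpha => //; exact: generated_leaf.
- move=> alpha.
  have [g gP] := words_not_dominating
    (fun w : words alpha => oapp (eval s op (alpha := alpha)) (fun=> 0%N) (GenTree.decode w)) dc.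
  exists g => y /(generated_eval FFop)[t <-].
  by have := gP (GenTree.encode t); rewrite GenTree.codeK.
- by move=> alpha F FF_F x xB; exact: generated_op.
Qed.

(** * P-points *)

(** The tasks are indexed by all sequences of sets.  The constant sequences are
    among them, and settling these makes the generated filter an ultrafilter;
    a sequence of members of the ultrafilter excludes the alternative in which
    a complement was added, and leaves a pseudointersection. *)
Theorem p_point_exists : is_dominating_number continuum ->
  exists u : set_system nat, p_point u.
Proof.
move=> dc; have [s s_onto] := continuum_onto_seq_set.
pose head S n : set nat := [set x | forall i, (i <= n)%N -> S i x].
pose R alpha P := (forall n, exists N, forall x, (P `\` s alpha n) x -> (x < N)%N) \/
  (exists n, P = ~` head (s alpha) n).
have [||f [fR fne]] := @transfinite_construction nat (fun n => [set m | (n <= m)%N])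
    (fun A => A !=set0) R.
- move=> ns; exists (\max_(n <- ns) n) => n /= nns.
  by rewrite (big_rem n) //= leq_maxl.
- move=> alpha X Xne Xcat Xcof.
  (* Does some finite intersection of the sequence miss a set already present? *)
  have [[w [n wn]]|noX] :=
      pselect (exists w n, X w `&` head (s alpha) n = set0).
    exists (~` head (s alpha) n); first by right; exists n.
    move=> v; have [x] := Xne (v ++ w); rewrite Xcat => -[Xv Xw].
    by exists x; split=> // hx; have : set0 x by rewrite -wn.
  have {noX}/choice[H HP] : forall w, exists h : nat -> nat,
      forall n, (X w `&` head (s alpha) n) (h n).
    move=> w; have h n : exists y, (X w `&` head (s alpha) n) y.
      by apply/set0P/eqP => wn; apply: noX; exists w, n.
    by have [H HP] := choice h; exists H.
  have [g [gmono _ gH]] := fast_growth (fun w n _ => H w n) dc.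
  (* Outside the [n]-th set only elements admitted before [n] remain: they are
     bounded by [g n]. *)
  exists [set x | exists2 n, head (s alpha) n x & (x <= g n.+1)%N].
    left=> n; exists (g n).+1.
    move=> x [[m hx xg] sx] /=; rewrite ltnS; apply: leq_trans xg (gmono _ _ _).
    by rewrite ltnNge; apply/negP => nm; apply: sx; exact: hx.
  move=> w; have [n _ Hn] := gH w 0%N; have [Xw hw] := HP w n.
  by exists (H w n); split=> //; exists n.
set u := generated_filter (fun n => [set m | (n <= m)%N]) f.
have uU : UltraFilter u.
  apply: generated_filter_ultra => // A.
  have [alpha aE] := s_onto (fun=> A); have [fin|[n fE]] := fR alpha.
    have [N NP] := fin 0%N; rewrite aE in NP.
    left; exists [:: inl N; inr alpha] => x [/= Nx [fx _]].
    by apply: contrapT => nA; have := NP x (conj fx nA); rewrite ltnNge Nx.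
  right; exists [:: inr alpha] => x [fx _]; move: fx; rewrite fE aE => nh Ax.
  by apply: nh.
have uF : Filter u by have [[_ ? ] _] := uU.
exists u; split=> //.
  move=> x uE; have : u [set m | (x < m)%N] by exact: generated_filter_base0.
  by rewrite uE => /principal_filterP /=; rewrite ltnn.
move=> S Sc Su.
have [e [Se eS]] := countable_enum setT Sc.
have ue n : u (e n) by have [/Su//|->] := eS n; exact: filterT.
have [alpha aE] := s_onto e.
have uf : u (f alpha) by exact: generated_filter_base.
exists (f alpha) => // A /Se[n _ <-].
have [/(_ n)[N NP]|[m fE]] := fR alpha.
  by rewrite aE in NP; apply: sub_finite_set (finite_II N) => x /NP.
rewrite aE in fE; have : u (head e m).
  have : u [set x | forall i : 'I_m.+1, e i x].
    by exact: (@filter_forall _ _ (fun i : 'I_m.+1 => e i) u uF (fun i => ue i)).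
  by apply: filterS => x ex i im; exact: (ex (Ordinal (im : (i < m.+1)%N))).
have nh : u (~` head e m) by rewrite -fE.
by move=> /(filterI nh); rewrite setICl => /filter_not_empty.
Qed.

(** * Perfect sets from nested clopen partitions *)

Lemma uniform_bound (Q : nat -> nat -> Prop) n :
  (forall i, {homo Q i : m m' / (m <= m')%N >-> m -> m'}) ->
  (forall i, (i < n)%N -> exists m, Q i m) ->
  exists m, forall i, (i < n)%N -> Q i m.
Proof.
move=> Qmono; elim: n => [|n IHn] Qex; first by exists 0%N.
have [|m mP] := IHn; first by move=> i /ltnW/Qex.
have [m' m'P] := Qex n (ltnSn n).
exists (maxn m m') => i; rewrite ltnS leq_eqVlt => /orP[/eqP ->|/mP].
  exact: Qmono (leq_maxr _ _) m'P.
exact: Qmono (leq_maxl _ _).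
Qed.

Section clopen_partitions.
(** A countable space without isolated points whose topology is given by finer
    and finer partitions into clopen sets: [e m] is the relation of lying in
    the same piece of the [m]-th partition.  The pieces containing [x] form a
    base of neighbourhoods of [x]. *)
Variables (T : countType) (e : nat -> T -> T -> Prop).
Hypotheses (e_refl : forall m x, e m x x)
  (e_sym : forall m x y, e m x y -> e m y x)
  (e_trans : forall m x y z, e m x y -> e m y z -> e m x z)
  (e_le : forall m n x y, (m <= n)%N -> e n x y -> e m x y)
  (e_sep : forall x y, (forall m, e m x y) -> x = y)
  (e_dense : forall x m, exists2 y, y <> x & e m y x).

Definition e_crowded (D : set T) : Prop :=
  forall x, D x -> forall m, exists y, [/\ D y, y <> x & e m y x].

Definition e_closed (P : set T) : Prop :=
  forall x, (forall m, exists2 y, P y & e m y x) -> P x.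

Definition nonscattered (A : set T) : Prop :=
  exists D, [/\ D `<=` A, D !=set0 & e_crowded D].

(** The perfect kernel: the union of all crowded subsets of [A]. *)
Definition kernel (A : set T) : set T :=
  [set x | exists D, [/\ D `<=` A, D x & e_crowded D]].

Lemma kernel_sub A : kernel A `<=` A.
Proof. by move=> x [D [DA Dx _]]; exact: DA. Qed.

Lemma kernel_crowded A : e_crowded (kernel A).
Proof.
move=> x [D [DA Dx Dc]] m; have [y [Dy yx yxm]] := Dc x Dx m.
by exists y; split=> //; exists D.
Qed.

(** The closure of a crowded set is crowded, and it stays inside [A]. *)
Lemma kernel_closed A : e_closed A -> e_closed (kernel A).
Proof.
move=> Acl x xcl.
exists [set y | forall m, exists2 z, kernel A z & e m z y]; split=> //.
  move=> y ycl; apply: Acl => m; have [z /kernel_sub Az zy] := ycl m.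
  by exists z.
move=> y ycl m; have [z kz zy] := ycl m.
have kcl t : kernel A t -> forall m, exists2 z, kernel A z & e m z t.
  by move=> kt n; exists t.
have [zyE|] := pselect (z = y); last by exists z; split=> //; exact: kcl.
rewrite zyE in kz; have [t [kt ty tym]] := kernel_crowded kz m.
by exists t; split=> //; exact: kcl.
Qed.

Lemma nonscatteredS A B : A `<=` B -> nonscattered A -> nonscattered B.
Proof. by move=> AB [D [DA D0 Dc]]; exists D; split=> //; exact: subset_trans AB. Qed.

(** Let [D] be a crowded subset of the union.  If some piece of [D] misses [A],
    that piece is a crowded subset of [B]; otherwise the trace of [A] is dense
    in [D], and a dense subset of a crowded set is crowded. *)
Lemma nonscatteredU A B :
  nonscattered (A `|` B) -> nonscattered A \/ nonscattered B.
Proof.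
move=> [D [DAB [d Dd] Dc]].
have [[x [m [Dx xA]]]|dense] :=
    pselect (exists x m, D x /\ forall y, D y -> A y -> ~ e m y x).
  right; exists [set y | D y /\ e m y x]; split.
  - by move=> y [Dy yx]; have [/(xA _ Dy)|//] := DAB _ Dy.
  - by exists x.
  - move=> y [Dy yx] n; have [z [Dz zy zyn]] := Dc y Dy (maxn m n).
    exists z; split=> //; last exact: e_le (leq_maxr _ _) zyn.
    by split=> //; apply: e_trans yx; exact: e_le (leq_maxl _ _) zyn.
have {}dense x m : D x -> exists y, [/\ D y, A y & e m y x].
  move=> Dx; apply: contrapT => nx; apply: dense; exists x, m; split=> // y Dy Ay yx.
  by apply: nx; exists y.
left; exists (D `&` A); split=> [x []//||x [Dx Ax] m].
  by have [y [Dy Ay _]] := dense d 0%N Dd; exists y.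
have [y [Dy yx yxm]] := Dc x Dx m.
have [n nyx] : exists n, ~ e n x y by apply/existsNP => /e_sep /esym.
have [z [Dz Az zy]] := dense y (maxn m n) Dy.
exists z; split=> //.
  by move=> zx; apply: nyx; rewrite -zx; exact: e_le (leq_maxr _ _) zy.
by apply: e_trans yxm; exact: e_le (leq_maxl _ _) zy.
Qed.

Lemma separate_finitely (a : T) n :
  exists m, forall r, (pickle r <= n)%N -> r <> a -> ~ e m r a.
Proof.
have [i m m' mm' Qm r ri ra| i _|m mP] := @uniform_bound
  (fun i m => forall r : T, pickle r = i -> r <> a -> ~ e m r a) n.+1.
- by move=> /(e_le mm'); exact: Qm.
- have [[r [ri ra]]|nr] := pselect (exists r : T, pickle r = i /\ r <> a).
    have [m rm] : exists m, ~ e m r a by apply/existsNP => /e_sep.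
    by exists m => r'; rewrite -ri => /(pcan_inj pickleK) ->.
  by exists 0%N => r ri ra; case: nr; exists r.
- by exists m => r rn; apply: (mP _ _ r erefl); rewrite ltnS.
Qed.

(** An exhaustion by proper subsets, each a union of pieces of every one of the
    partitions and so clopen; the complements are the initial sets of
    the construction.  They keep the ultrafilter away from every point of
    the space, as they must: a closed set inside the complement of a point
    avoids a neighbourhood of that point. *)
Variable E : nat -> set T.
Hypotheses (E_le : forall m n, (m <= n)%N -> E m `<=` E n)
  (E_cover : forall x, exists n, E n x)
  (E_e : forall n m x y, e m x y -> E n x -> E n y)
  (E_proper : forall n, ~` E n !=set0).

Lemma nonscatteredCE n : nonscattered (~` E n).
Proof.
exists (~` E n); split=> // x Ex m; have [y yx yxm] := e_dense x m.
by exists y; split=> // Ey; exact/Ex/(E_e yxm).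
Qed.

Lemma closedCE n : e_closed (~` E n).
Proof. by move=> x /(_ 0%N)[y Ey yx] Ex; exact/Ey/(E_e (e_sym yx)). Qed.

Section closed_trace.
Variables (A : set T) (mu : T -> nat -> nat) (g : baire).
Hypothesis muP : forall a n r, (pickle r <= n)%N -> r <> a -> ~ e (mu a n) r a.

(** A closed subset of [A] controlled by the growth of [g].  For each [n] a point
    of [E n] has to lie in one of finitely many clopen pieces, those around the
    points of [A] with code at most [g n] at depth [mu a n]; these pieces avoid
    all points outside [A] with code at most [n].  Points outside [E n] are not
    restricted at [n], so that every point is free of the first conditions if
    it is far enough. *)
Definition closed_trace : set T := [set x | forall n, E n x ->
  exists a, [/\ A a, (pickle a <= g n)%N & e (mu a n) x a]].

Lemma closed_trace_sub : closed_trace `<=` A.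
Proof.
move=> x xP; apply: contrapT => nAx; have [n0 En0x] := E_cover x.
pose n := maxn n0 (pickle x).
have [a [Aa _ xa]] := xP n (E_le (leq_maxl _ _) En0x).
by apply: (muP (leq_maxr n0 (pickle x))) xa => xE; apply: nAx; rewrite xE.
Qed.

Hypothesis g_mono : {homo g : m n / (m <= n)%N}.
Variable M : nat -> nat -> nat.
Hypothesis M_ge : forall n v, (n <= M n v)%N.
Hypothesis M_mu : forall n v a i, (pickle a <= v)%N -> (i <= n)%N ->
  (mu a i <= M n v)%N.

Lemma closed_trace_closed : e_closed closed_trace.
Proof.
move=> x xcl n Enx; have [y yP yx] := xcl (M n (g n)).
have [a [Aa ag ya]] := yP n (E_e (e_sym yx) Enx).
exists a; split=> //; apply: e_trans ya; apply: e_sym.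
by apply: e_le yx; exact: M_mu.
Qed.

Hypothesis g_ge : forall n, (n <= g n)%N.

(** The trace on [D] is itself crowded.  Given a point [x] of it, take a large
    [n] at which [g] meets the demand [H].  The demand provides a second point
    [y] of [D] so close to [x] that [y] inherits the conditions up to [n], and
    with code at most [g n.+1], so that [y] is its own witness for the later
    ones.  A point of [D] outside [E n] with code at most [g n.+1] shows in the
    same way that the trace is nonempty. *)
Lemma closed_trace_nonscattered (D : set T) (H : nat -> nat -> nat) :
  D `<=` A ->
  (forall n v, exists d, [/\ D d, ~ E n d & (pickle d <= H n v)%N]) ->
  (forall n v x, D x -> (pickle x <= v)%N -> exists y,
    [/\ D y, y <> x, e (M n v) y x & (pickle y <= H n v)%N]) ->
  (forall m, exists2 n, (m <= n)%N & (H n (g n) <= g n.+1)%N) ->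
  nonscattered (closed_trace `&` D).
Proof.
move=> DA D_far D_near gH; exists (closed_trace `&` D); split=> //.
  have [n _ Hn] := gH 0%N; have [d [Dd Ed dn]] := D_far n (g n).
  exists d; split=> // i Eid; exists d; split=> //; first exact: DA.
  apply: leq_trans dn (leq_trans Hn (g_mono _)).
  by rewrite ltnNge; apply/negP => /E_le/(_ _ Eid).
move=> x [xP Dx] m; have [n mn Hn] := gH (maxn m (pickle x)).
have xg : (pickle x <= g n)%N.
  exact: leq_trans (leq_trans (leq_maxr _ _) mn) (g_ge n).
have [y [Dy yx yxM yH]] := D_near n (g n) x Dx xg.
exists y; split=> //; last first.
  by apply: e_le yxM; apply: leq_trans (leq_trans (leq_maxl _ _) mn) _.
split=> // i Eiy; have [ni|iN] := ltnP n i.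
  exists y; split=> //; first exact: DA.
  exact: leq_trans yH (leq_trans Hn (g_mono ni)).
have [a [Aa ag xa]] := xP i (E_e yxM Eiy).
exists a; split=> //; apply: e_trans xa; apply: e_le yxM.
by apply: M_mu => //; apply: leq_trans ag (g_mono iN).
Qed.

End closed_trace.

(** Each [D w] is crowded and leaves every [E n], so it yields a demand as
    required by [closed_trace_nonscattered]; one function [g] meets the
    demands of all the words infinitely often. *)
Lemma closed_refinement (alpha : continuum) (X : words alpha -> set T) A :
  is_dominating_number continuum ->
  (forall w n, exists v, X v `<=` X w `\` E n) ->
  (forall w, nonscattered (X w `&` A)) ->
  exists P, [/\ P `<=` A, e_closed P & forall w, nonscattered (P `&` X w)].
Proof.
move=> dc Xfar XA.
have /choice[mu muP] : forall a, exists f : nat -> nat, forall n r,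
    (pickle r <= n)%N -> r <> a -> ~ e (f n) r a.
  by move=> a; have [f fP] := choice (separate_finitely a); exists f.
have {}muP a n r : (pickle r <= n)%N -> r <> a -> ~ e (mu a n) r a by exact: muP.
have /choice[M MP] : forall nv : nat * nat, exists m, (nv.1 <= m)%N /\
    forall a i, (pickle a <= nv.2)%N -> (i <= nv.1)%N -> (mu a i <= m)%N.
  move=> [n v] /=; have [i m m' mm' Qm a ai j jn|i _|m mP] := @uniform_bound
    (fun i m => forall a, pickle a = i -> forall j, (j <= n)%N -> (mu a j <= m)%N) v.+1.
  - exact: leq_trans (Qm _ ai _ jn) mm'.
  - have [[a ai]|na] := pselect (exists a : T, pickle a = i); last first.
      by exists 0%N => a ai; case: na; exists a.
    exists (\max_(j < n.+1) mu a j) => a'; rewrite -ai => /(pcan_inj pickleK) -> j jn.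
    exact: (leq_bigmax (F := fun j : 'I_n.+1 => mu a j) (Ordinal (jn : (j < n.+1)%N))).
  - exists (maxn n m); split=> [|a i av iN]; first exact: leq_maxl.
    exact: leq_trans (mP _ av a erefl i iN) (leq_maxr _ _).
pose D w := kernel (X w `&` A).
have D_far w n : exists2 d, D w d & ~ E n d.
  have [v vw] := Xfar w n; have [K [KX [d Kd] Kc]] := XA v.
  have [/vw[_ nE] _] := KX _ Kd; exists d => //; exists K; split=> // x Kx.
  by have [/vw[] ] := KX _ Kx.
have /choice[H HP] : forall t : words alpha * (nat * nat), exists m,
    (exists d, [/\ D t.1 d, ~ E t.2.1 d & (pickle d <= m)%N]) /\
    (forall x, D t.1 x -> (pickle x <= t.2.2)%N -> exists y,
      [/\ D t.1 y, y <> x, e (M t.2) y x & (pickle y <= m)%N]).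
  move=> [w [n v]] /=.
  have [d Dd nE] := D_far w n.
  have [i m m' mm' Qm x xi Dx|i _|m mP] := @uniform_bound
    (fun i m => forall x, pickle x = i -> D w x -> exists y,
      [/\ D w y, y <> x, e (M (n, v)) y x & (pickle y <= m)%N]) v.+1.
  - have [y [Dy yx yxM ym]] := Qm _ xi Dx.
    by exists y; split=> //; exact: leq_trans ym mm'.
  - have [[x [xi Dx]]|nx] := pselect (exists x, pickle x = i /\ D w x); last first.
      by exists 0%N => x xi Dx; case: nx; exists x.
    have [y [Dy yx yxM]] := kernel_crowded Dx (M (n, v)).
    by exists (pickle y) => x'; rewrite -xi => /(pcan_inj pickleK) -> _; exists y.
  - exists (maxn (pickle d) m); split; first by exists d; split=> //; exact: leq_maxl.
    move=> x Dx xv; have [y [Dy yx yxM ym]] := mP _ xv x erefl Dx.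
    by exists y; split=> //; exact: leq_trans ym (leq_maxr _ _).
have [g [gmono gge gH]] := fast_growth (fun w n v => H (w, (n, v))) dc.
exists (closed_trace A mu g); split.
- exact: closed_trace_sub.
- apply: (@closed_trace_closed _ _ _ (fun n v => M (n, v))) => n v a i.
  by have [_] := MP (n, v); exact.
- move=> w; apply: (@nonscatteredS (closed_trace A mu g `&` D w)).
    by apply: setIS => x /kernel_sub[].
  apply: (@closed_trace_nonscattered _ _ _ gmono (fun n v => M (n, v)) _ _ gge _
      (fun n v => H (w, (n, v)))) => //.
  + by move=> n v; have [] := MP (n, v).
  + by move=> n v a i; have [_] := MP (n, v); exact.
  + by move=> x /kernel_sub[].
  + by move=> n v; have [] := HP (w, (n, v)).
  + by move=> n v x; have [_] := HP (w, (n, v)); exact.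
Qed.

(** The ultrafilter is generated by closed sets with non-scattered finite
    intersections.  It contains the kernel of each such intersection: a set in
    the filter disjoint from the kernel would have a crowded subset inside the
    intersection, and that subset belongs to the kernel. *)
Theorem perfect_ultrafilter_exists : is_dominating_number continuum ->
  exists u : set_system T, UltraFilter u /\ forall A, u A ->
    exists P, [/\ u P, e_closed P, e_crowded P & P `<=` A].
Proof.
move=> dc; have [s s_onto] := continuum_onto_set T.
pose base n := ~` E n.
pose R alpha P := e_closed P /\ (P `<=` s alpha \/ P `<=` ~` s alpha).
have [||f [fR fns]] := @transfinite_construction T base nonscattered R.
- move=> ns; apply: (@nonscatteredS (~` E (\max_(n <- ns) n))); last exact: nonscatteredCE.
  move=> x Ex n /= nns; apply: contra_not Ex => /E_le; apply.
  by rewrite (big_rem n) //= leq_maxl.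
- move=> alpha X Xns Xcat Xbase.
  have Xfar w n : exists v, X v `<=` X w `\` E n.
    by have [v vE] := Xbase n; exists (w ++ v); rewrite Xcat => x [? /vE].
  have [XA|/existsNP[w nwA]] := pselect (forall w, nonscattered (X w `&` s alpha)).
    have [P [PA Pcl PX]] := closed_refinement dc Xfar XA.
    by exists P => //; split=> //; left.
  (* If both traces could be scattered, for [w] and for [v], then so would be the
     set of index [w ++ v]. *)
  have XA v : nonscattered (X v `&` ~` s alpha).
    have : nonscattered (X (w ++ v)) by [].
    rewrite Xcat -(setIT (_ `&` _)) -(setUCr (s alpha)) setIUr => /nonscatteredU[].
      by move=> /(@nonscatteredS _ (X w `&` s alpha)) => /(_ _)/nwA[] // x [[]].
    by apply: nonscatteredS => x [[]].
  have [P [PA Pcl PX]] := closed_refinement dc Xfar XA.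
  by exists P => //; split=> //; right.
set u := generated_filter base f.
have uf alpha : u (f alpha) by exact: generated_filter_base.
have udec A : u A \/ u (~` A).
  have [alpha aE] := s_onto A; have [_] := fR alpha; rewrite aE.
  by move=> [fA|fA]; [left|right]; exists [:: inr alpha] => x [/fA].
have uU : UltraFilter u.
  apply: generated_filter_ultra => // w.
  by have [D [DX [x Dx] _]] := fns w; exists x; exact: DX.
exists u; split=> // A [w wA].
have wcl : e_closed (word_meet base f w).
  elim: (w) => [|a l IHl] //= x xcl; split.
    have {}xcl m : exists2 y, match a with inl n => base n | inr i => f i end y & e m y x.
      by have [y [? _] ?] := xcl m; exists y.
    by case: a xcl => [n|i] /= xcl; [exact: closedCE xcl|have [icl _] := fR i; exact: icl].
  by apply: IHl => m; have [y [_ ?] ?] := xcl m; exists y.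
exists (kernel (word_meet base f w)); split.
- have [//|[v vK]] := udec (kernel (word_meet base f w)).
  have [D [Dvw [x Dx] Dc]] := fns (v ++ w); rewrite word_meet_cat in Dvw.
  have [/vK xK _] := Dvw _ Dx; case: xK; exists D; split=> // y Dy.
  by have [] := Dvw _ Dy.
- exact: kernel_closed.
- exact: kernel_crowded.
- by move=> x /kernel_sub /wA.
Qed.

End clopen_partitions.

(** * The rational line *)

Section rationals.
Variable R : realType.
Local Open Scope ring_scope.

(** The line is cut at the points k / (i + 1) - pi, k an integer.  They are
    irrational, so the traces of the half-open cells on the rationals are
    clopen. *)
Definition cell (i : nat) (x : rat) : int :=
  Num.floor (i.+1%:R * (ratr x + pi) : R).

Definition same_cells (m : nat) (x y : rat) : Prop :=
  forall i, (i <= m)%N -> cell i x = cell i y.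

Lemma same_cells_dist m x y : same_cells m y x ->
  `|ratr x - ratr y : R| < m.+1%:R^-1.
Proof.
move=> /(_ m (leqnn m)); rewrite /cell => E.
have m0 : 0 < m.+1%:R :> R by rewrite ltr0n.
rewrite -[ltRHS]mul1r ltr_pdivlMr// -[X in _ * X]gtr0_norm// -normrM ltr_norml.
have := floor_itv (m.+1%:R * (ratr x + pi) : R).
have := floor_itv (m.+1%:R * (ratr y + pi) : R).
rewrite E !intrD => /andP[y1 y2] /andP[x1 x2]; apply/andP; split; lra.
Qed.

Lemma same_cells_sep x y : (forall m, same_cells m x y) -> x = y.
Proof.
move=> xy; apply: (fmorph_inj (@ratr R)); apply/eqP; rewrite -subr_eq0 -normr_eq0.
rewrite eq_le normr_ge0 andbT leNgt; apply/negP => d0.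
have [m] := ltr_add_invr d0; rewrite add0r distrC => /(lt_trans (same_cells_dist (xy m))).
by rewrite ltxx.
Qed.

Lemma rat_nbhsP (x : rat) (V : set rat) :
  nbhs (x : rat_in R) V <->
  exists2 eps : R, 0 < eps & forall y, `|ratr x - ratr y : R| < eps -> V y.
Proof.
split.
  rewrite nbhsE => -[W [[U Uo <-] Ux] UV].
  have /nbhs_ballP[eps /= eps0 epsU] : nbhs (ratr x : R) U by exact: open_nbhs_nbhs.
  by exists eps => // y xy; apply: UV; exact: epsU.
move=> [eps eps0 epsV].
have : nbhs (ratr x : R) (ball (ratr x : R) eps) by exact: nbhsx_ballx.
move=> /(@initial_continuous _ _ (ratr : rat -> R) x) H.
have {}H : nbhs (x : rat_in R) (ratr @^-1` ball (ratr x : R) eps) := H.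
by apply: filterS H => y /= /epsV.
Qed.

Lemma cell_itv i x : (cell i x)%:~R < i.+1%:R * (ratr x + pi : R) < (cell i x)%:~R + 1.
Proof.
have /andP[] := floor_itv (i.+1%:R * (ratr x + pi) : R).
rewrite -/(cell i x) intrD le_eqVlt => /orP[/eqP E|->->//] _; exfalso.
apply: (@pi_irrationnal R); exists ((cell i x)%:~R / i.+1%:R - x) => //.
rewrite rmorphB /= fmorph_div /= rmorph_int ratr_nat E.
by rewrite mulrAC mulfV ?pnatr_eq0// mul1r addrC addKr.
Qed.

(** A rational point is interior to its cells, since it is not a cut point. *)
Lemma same_cells_nbhs m (x : rat) :
  nbhs (x : rat_in R) [set y | same_cells m y x].
Proof.
pose slab (i : 'I_m.+1) : set R :=
  [set t | (cell i x)%:~R < i.+1%:R * (t + pi : R) < (cell i x)%:~R + 1].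
have slab_nbhs i : nbhs (ratr x : R) (slab i).
  have /andP[lo hi] := cell_itv i x.
  have i0 : 0 < i.+1%:R :> R by rewrite ltr0n.
  have : (ratr x : R) \in
      `](cell i x)%:~R / i.+1%:R - pi, ((cell i x)%:~R + 1) / i.+1%:R - pi[%R.
    by rewrite in_itv /= ltrBlDr ltrBrDr ltr_pdivrMr// ltr_pdivlMr// ![_ * i.+1%:R]mulrC lo.
  move=> /near_in_itvoo; apply: filterS => t; rewrite /slab /= in_itv /=.
  by rewrite ltrBlDr ltrBrDr ltr_pdivrMr// ltr_pdivlMr// ![_ * i.+1%:R]mulrC.
have := @filter_forall _ _ slab _ (nbhs_filter (ratr x : R)) slab_nbhs.
move=> /(@initial_continuous _ _ (ratr : rat -> R) x) H.
apply: (@filterS _ (nbhs (x : rat_in R)) _ _ _ _ H) => y /= yP i im.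
have /andP[lo hi] := yP (Ordinal (im : (i < m.+1)%N)).
by apply: floor_def; rewrite intrD hi ltW.
Qed.

Lemma same_cells_dense x m : exists2 y, y <> x & same_cells m y x.
Proof.
have /rat_nbhsP[eps eps0 epsP] := same_cells_nbhs m x.
have [k] := ltr_add_invr eps0; rewrite add0r => ke.
exists (x + k.+1%:R^-1); last first.
  apply: epsP; rewrite rmorphD /= opprD addNKr normrN fmorphV rmorph_nat.
  by rewrite gtr0_norm// invr_gt0 ltr0n.
by move=> /(canRL (addKr _)); rewrite addNr => /eqP; rewrite invr_eq0 pnatr_eq0.
Qed.

Definition left_part (n : nat) : set rat := [set x | (cell 0 x < n%:Z)%R].

Theorem gruff_exists : is_dominating_number continuum ->
  exists u : set_system rat, gruff R u.
Proof.
move=> dc.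
have [||||||||||u [uU uP]] := @perfect_ultrafilter_exists rat same_cells
  _ _ _ _ _ _ left_part _ _ _ _ dc.
- by [].
- by move=> m x y xy i im; rewrite xy.
- by move=> m x y z xy yz i im; rewrite xy ?yz.
- by move=> m n x y mn xy i im; apply: xy; exact: leq_trans mn.
- exact: same_cells_sep.
- exact: same_cells_dense.
- by move=> m n mn x /lt_le_trans; apply; rewrite lez_nat.
- by move=> x; exists `|cell 0 x|.+1; rewrite /left_part /= intS ltz1D// lez_abs.
- by move=> n m x y /(_ 0%N isT); rewrite /left_part /= => ->.
- move=> n; exists n%:R; apply/negP; rewrite -leNgt /cell Num.Theory.floor_ge_int.
  by rewrite mul1r ratr_nat lerDl pi_ge0.
exists u; split=> // A /uP[P [uP' Pcl Pcr PA]]; exists P; split=> //; split.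
  move=> x xP; apply: Pcl => m.
  by have [y [Py yx]] := xP _ (same_cells_nbhs m x); exists y.
rewrite -subset0 => x [/set_mem Px [V xV VP]].
have /rat_nbhsP[eps eps0 epsV] := xV.
have [m] := ltr_add_invr eps0; rewrite add0r => me.
have [y [Py yx /same_cells_dist yxm]] := Pcr x Px m.
have : (V `&` P) y by split=> //; apply: epsV; exact: lt_trans me.
by rewrite VP => /yx.
Qed.
End rationals.

Theorem corollary4p5 (R : realType) :
  is_dominating_number continuum ->
  (forall FF : set operation, finite_set FF ->
     exists B : continuum -> set baire, pathway FF B) /\
  (exists u : set_system nat, p_point u) /\
  (exists u : set_system rat, gruff R u).
Proof.
move=> dc; split; last by split; [exact: p_point_exists|exact: gruff_exists].
by move=> FF; exact: pathway_exists.
Qed.
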